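(* For every integer $i$ with $0\le i\le N$, the $W$-currents satisfy the duality $$T_{2N+1-i}(z)=\frac{\left[r-\frac12\right]_x}{\left[\frac12\right]_x}\ \prod_{k=1}^{N-i}\Delta\left(x^{2k}\right)\ T_i(z),$$ as an identity of formal series in $z$ with coefficients acting on the Fock space $\pi_\lambda$ (empty products are $1$).
   Context: Parameters: $N\ge 1$ is an integer, $r>1$ is real, $x\in\mathbb C$ with $0<|x|<1$. Powers of $x$ are taken with a fixed choice of $\log x$, and $[a]_x=\frac{x^a-x^{-a}}{x-x^{-1}}$ for real $a$. Put $$\Delta(z)=\frac{(1-x^{2r-1}z)(1-x^{-2r+1}z)}{(1-xz)(1-x^{-1}z)}.$$ Heisenberg algebra: $B(m)=(B_{i,j}(m))_{i,j=1}^N$, $m\in\mathbb Z$, is the symmetric matrix with, for $m\ne0$, $B_{i,i}(m)=\frac{[2m]_x}{[m]_x}$ for $1\le i\le N-1$, $B_{N,N}(m)=\frac{[2m]_x-[m]_x}{[m]_x}$, $B_{i,j}(m)=-1$ if $|i-j|=1$, $B_{i,j}(m)=0$ if $|i-j|\ge2$; and $B_{i,i}(0)=2$ for $i\le N-1$, $B_{N,N}(0)=1$, $B_{i,j}(0)=-1$ if $|i-j|=1$, $0$ if $|i-j|\ge2$. The Heisenberg algebra $\mathcal H_{x,r}$ has generators $a_i(m),Q_i$ ($m\in\mathbb Z$, $1\le i\le N$) with $$[a_i(m),a_j(n)]=\tfrac1m[rm]_x[(r-1)m]_xB_{i,j}(m)(x-x^{-1})^2\delta_{m+n,0}\ (m,n\neq0),\qquad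 [a_i(0),Q_j]=B_{i,j}(0),$$ all other commutators vanishing. Let $I(m)=B(m)^{-1}$, $y_i(m)=\sum_jI_{i,j}(m)a_j(m)$, $Q_i^y=\sum_jI_{i,j}(0)Q_j$. The vacuum $|0\rangle\neq 0$ satisfies $a_i(m)|0\rangle=0$ for $m\ge0$, and $\pi_\lambda$ is the Fock space generated by $|\lambda\rangle=e^{\lambda}|0\rangle$, $\lambda=\sum_j\lambda_jQ_j^y$ (so $a_i(0)|\lambda\rangle=\lambda_i|\lambda\rangle$, $a_i(m)|\lambda\rangle=0$ for $m>0$). Normal ordering ${:}\ {:}$ moves all $a_i(m)$ with $m\ge0$ to the right of those with $m<0$. Inside normal ordering, the inverse of an exponential is obtained by changing the sign of the exponent. Vertex operators: $A_i(z)=x^{ra_i(0)}{:}\exp\big(\sum_{m\neq0}a_i(m)z^{-m}\big){:}$, $\ Y_i(z)=x^{ry_i(0)}{:}\exp\big(\sum_{m\ne0}y_i(m)z^{-m}\big){:}$. Index set: $J_N=\{1,\dots,N,0,\overline N,\dots,\overline1\}$, ordered $1\prec2\prec\cdots\prec N\prec0\prec\overline N\prec\cdots\prec\overline1$, with $\overline{\overline k}=k$ and $\overline0=0$. Set $\Lambda_1(z)=Y_1(z)$; $\Lambda_k(z)={:}\Lambda_{k-1}(z)A_{k-1}(x^{-k+1}z)^{-1}{:}$ ($2\le k\le N$); $\Lambda_0(z)=\frac{[r-\frac12]_x}{[\frac12]_x}{:}\Lambda_N(z)A_N(x^{-N}z)^{-1}{:}$; $\Lambda_{\overline N}(z)=\frac{[\frac12]_x}{[r-\frac12]_x}{:}\Lambda_0(z)A_N(x^{-N-1}z)^{-1}{:}$;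 $\Lambda_{\overline k}(z)={:}\Lambda_{\overline{k+1}}(z)A_k(x^{-2N+k-1}z)^{-1}{:}$ ($1\le k\le N-1$). $W$-currents: for $\Omega=\{s_1\prec s_2\prec\cdots\prec s_i\}\subset J_N$ set $$d_\Omega(x,r)=\prod_{\substack{1\le p<q\le i\\ s_q=\overline{s_p}}}\Delta\big(x^{2(q-p+s_p-N-1)}\big),\qquad \overrightarrow\Lambda_\Omega(z)={:}\Lambda_{s_1}(x^{-i+1}z)\Lambda_{s_2}(x^{-i+3}z)\cdots\Lambda_{s_i}(x^{i-1}z){:},$$ with $d_\varnothing=1$, $\overrightarrow\Lambda_\varnothing=1$ (in the product, $s_p\in\{1,\dots,N\}$ is used as an integer). Then $T_0(z)=1$ and $T_i(z)=\sum_{\Omega\subset J_N,\,|\Omega|=i}d_\Omega(x,r)\overrightarrow\Lambda_\Omega(z)$ for $1\le i\le 2N+1$. *)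

(* Defs.v *)
From HB Require Import structures.
From mathcomp Require Import all_boot all_order all_algebra.
From mathcomp Require Import complex.
From mathcomp Require Import all_classical all_reals.
From mathcomp Require Import sequences exp trigo.

Set Implicit Arguments.
Unset Strict Implicit.
Unset Printing Implicit Defensive.

Import Order.TTheory GRing.Theory Num.Theory.
Local Open Scope ring_scope.
Local Open Scope complex_scope.

Definition cexp (R : realType) (z : R[i]) : R[i] :=
  (expR (complex.Re z))%:C * (cos (complex.Im z) +i* sin (complex.Im z)).

Section Currents.
Variables (R : realType) (N : nat) (r : R).
(* [lx] is the chosen logarithm of [x]: the theorem assumes [cexp lx = x]. *)
Variables (x lx : R[i]).

Definition xpow (c : R[i]) : R[i] := cexp (c * lx).

Definition qint (c : R) : R[i] := (xpow c%:C - xpow (- c)%:C) / (x - x^-1).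

Definition Delta (z : R[i]) : R[i] :=
  (1 - xpow (2 * r - 1)%:C * z) * (1 - xpow (- (2 * r) + 1)%:C * z)
  / ((1 - x * z) * (1 - x^-1 * z)).

(* Row and column [i : 'I_N] stand for the index [i.+1] in {1, ..., N}. *)
Definition Bmx (m : int) : 'M[R[i]]_N := \matrix_(i, j)
  if i == j then
    if i.+1 == N then
      if m == 0 then 1
      else (qint (2 * m%:~R) - qint m%:~R) / qint m%:~R
    else
      if m == 0 then 2 else qint (2 * m%:~R) / qint m%:~R
  else if (i.+1 == j) || (j.+1 == i) then -1 else 0.

Definition Imx (m : int) : 'M[R[i]]_N := invmx (Bmx m).

(* A [vertex] denotes the vertex operator
     scal * x^(\sum_j zero j * a_j(0)) * :exp(\sum_(m <> 0, j) osc m j * a_j(m) z^-m):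
   ([osc 0] is irrelevant).  Inside normal ordering all factors commute, so the
   normally ordered product of two such operators multiplies the scalars and
   adds the exponents. *)
Record vertex := Vertex {
  scal : R[i];
  zero : 'I_N -> R[i];
  osc : int -> 'I_N -> R[i] }.

Definition vone : vertex := Vertex 1 (fun _ => 0) (fun _ _ => 0).

Definition vmul (u v : vertex) : vertex :=
  Vertex (scal u * scal v) (fun j => zero u j + zero v j)
    (fun m j => osc u m j + osc v m j).

Definition vinv (u : vertex) : vertex :=
  Vertex (scal u)^-1 (fun j => - zero u j) (fun m j => - osc u m j).

Definition vscale (c : R[i]) (u : vertex) : vertex :=
  Vertex (c * scal u) (zero u) (osc u).

(* substitution of [c * z] for [z] *)
Definition vsubst (c : R[i]) (u : vertex) : vertex :=
  Vertex (scal u) (zero u) (fun m j => c ^ (- m) * osc u m j).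

(* coordinates of a_k(m) and y_k(m), 1 <= k <= N, in the a_j(m) *)
Definition acoord (k : nat) (m : int) (j : 'I_N) : R[i] := (j.+1 == k)%:R.
Definition ycoord (k : nat) (m : int) (j : 'I_N) : R[i] :=
  \sum_(i < N | i.+1 == k) Imx m i j.

Definition A (k : nat) : vertex :=
  Vertex 1 (fun j => r%:C * acoord k 0 j) (acoord k).
Definition Y (k : nat) : vertex :=
  Vertex 1 (fun j => r%:C * ycoord k 0 j) (ycoord k).

(* [Lpos k] is Lambda_(k+1) for 0 <= k < N. *)
Fixpoint Lpos (k : nat) : vertex :=
  if k is k'.+1 then
    vmul (Lpos k') (vinv (vsubst (xpow (- k%:R)) (A k)))
  else Y 1.

Definition Lzero : vertex :=
  vscale (qint (r - 2^-1) / qint 2^-1)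
    (vmul (Lpos N.-1) (vinv (vsubst (xpow (- N%:R)) (A N)))).

(* [Lbar j] is Lambda_(bar k) with k = N - j, for 0 <= j < N. *)
Fixpoint Lbar (j : nat) : vertex :=
  if j is j'.+1 then
    let k := (N - j)%N in
    vmul (Lbar j') (vinv (vsubst (xpow (- (2 * N%:R) + k%:R - 1)) (A k)))
  else
    vscale (qint 2^-1 / qint (r - 2^-1))
      (vmul Lzero (vinv (vsubst (xpow (- N%:R - 1)) (A N)))).

(* J_N is encoded by its order isomorphism with 'I_(2N+1): the position of k is
   k - 1, that of 0 is N, that of bar k is 2N + 1 - k; thus bar is [rev_ord]. *)
Definition J : finType := 'I_N.*2.+1.

Definition Lambda (s : J) : vertex :=
  if (s < N)%N then Lpos s else if (s == N :> nat) then Lzero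
  else Lbar (s - N.+1).

(* [enum_val] lists Omega in increasing order.  The positions p, q are counted
   from 0 here, and s_p is the integer [(enum_val p).+1]. *)
Definition dOmega (Om : {set J}) : R[i] :=
  \prod_(p < #|Om|) \prod_(q < #|Om| | (p < q)%N &&
      (enum_val q == rev_ord (enum_val p)))
    Delta (xpow (2 * (q%:R - p%:R + (enum_val p).+1%:R - N%:R - 1))).

Definition LOmega (Om : {set J}) : vertex :=
  \big[vmul/vone]_(p < #|Om|)
    vsubst (xpow (- #|Om|%:R + 1 + 2 * p%:R)) (Lambda (enum_val p)).

Section Representation.
Variables (V : lmodType R[i]).
Variables (a : 'I_N -> int -> {linear V -> V}) (Q : 'I_N -> {linear V -> V}).

Definition comm (f g : V -> V) (v : V) : V := f (g v) - g (f v).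

(* V is a module over the Heisenberg algebra. *)
Record heisenberg : Prop := Heisenberg {
  heis_aa : forall i j m n v, m != 0 -> n != 0 ->
    comm (a i m) (a j n) v =
      ((m + n == 0)%:R * (m%:~R^-1 * qint (r * m%:~R) * qint ((r - 1) * m%:~R)
        * Bmx m i j * (x - x^-1) ^+ 2)) *: v;
  heis_a0a : forall i j n v, comm (a i 0) (a j n) v = 0;
  heis_a0Q : forall i j v, comm (a i 0) (Q j) v = Bmx 0 i j *: v;
  heis_aQ : forall i j m v, m != 0 -> comm (a i m) (Q j) v = 0;
  heis_QQ : forall i j v, comm (Q i) (Q j) v = 0 }.

Definition Qy (j : 'I_N) (v : V) : V := \sum_k Imx 0 j k *: Q k v.

Definition lamQ (lam : 'I_N -> R[i]) (v : V) : V := \sum_j lam j *: Qy j v.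

(* The exponential series of an operator has no meaning on an arbitrary V;
   e^lam is given by the properties of a formal exponential.  Since
   [a_i(m), lam] is a scalar, [a_i(m), e^lam] = [a_i(m), lam] e^lam. *)
Record exponential (eQ : ('I_N -> R[i]) -> {linear V -> V}) : Prop :=
  Exponential {
  exp0 : forall v, eQ (fun _ => 0) v = v;
  expD : forall lam mu v, eQ (fun j => lam j + mu j) v = eQ lam (eQ mu v);
  exp_a : forall lam i m v,
    comm (a i m) (eQ lam) v = comm (a i m) (lamQ lam) (eQ lam v);
  exp_Q : forall lam j v, comm (Q j) (eQ lam) v = 0 }.

Record vacuum (vac : V) : Prop := Vacuum {
  vac_neq0 : vac != 0;
  vac_ann : forall i m, 0 <= m -> a i m vac = 0 }.

Inductive fock (ket : V) : V -> Prop :=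
| fock_ket : fock ket ket
| fock_create i m v : m < 0 -> fock ket v -> fock ket (a i m v)
| fock_lin c u v : fock ket u -> fock ket v -> fock ket (c *: u + v).

(* :a_(i_1)(m_1) ... a_(i_l)(m_l): applied to v *)
Definition normal_order (w : seq ('I_N * int)) (v : V) : V :=
  foldr (fun l => a l.1 l.2) v
    ([seq l <- w | l.2 < 0] ++ [seq l <- w | 0 <= l.2]).

Definition words (n : int) : set (seq ('I_N * int)) :=
  [set w | all (fun l => l.2 != 0) w /\ \sum_(l <- w) l.2 = - n]%classic.

(* Coefficient of z^n of the vertex operator [u], acting on pi_lam, where a_j(0)
   is the scalar [lam j] (see [fock_a0]).  The exponential series is expanded
   into words; on a vector of pi_lam only finitely many words of given total
   mode are nonzero, so the finitely supported sum is the actual sum. *)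
Definition vcoef (lam : 'I_N -> R[i]) (u : vertex) (n : int) (v : V) : V :=
  (scal u * xpow (\sum_j zero u j * lam j)) *:
  \sum_(w \in words n)
    ((size w)`!%:R^-1 * \prod_(l <- w) osc u l.2 l.1) *: normal_order w v.

(* coefficient of z^n in T_i(z), acting on pi_lam *)
Definition T (lam : 'I_N -> R[i]) (i : nat) (n : int) (v : V) : V :=
  \sum_(Om : {set J} | #|Om| == i) dOmega Om *: vcoef lam (LOmega Om) n v.

Lemma Bmx0_unit : Bmx 0 \in unitmx.
Proof.
pose D : 'M[R[i]]_N := \matrix_(i, j) ((j == i)%:R - (j == i.+1 :> nat)%:R).
have detD : \det D = 1.
  rewrite -det_tr det_trig; last first.
    apply/is_trig_mxP => i j ij; rewrite !mxE.
    by rewrite -val_eqE /= !ltn_eqF ?subr0 // ltnW.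
  by rewrite big1 // => i _; rewrite !mxE eqxx ltn_eqF ?subr0.
suff -> : Bmx 0 = D *m D^T.
  by rewrite unitmxE det_mulmx det_tr detD mulr1 unitr1.
apply/matrixP => i j; rewrite !mxE /=.
have step k : D i k * D^T k j =
    (k == i)%:R * (D j k) - (k == i.+1 :> nat)%:R * D j k.
  by rewrite !mxE mulrBl.
rewrite (eq_bigr _ (fun k _ => step k)) sumrB.
have -> : \sum_k (k == i)%:R * D j k = D j i.
  rewrite (bigD1 i) //= eqxx mul1r big1 ?addr0 // => k /negbTE ->.
  by rewrite mul0r.
case: (ltnP i.+1 N) => iN; last first.
  have eN : i.+1 = N by apply/eqP; rewrite eqn_leq iN ltn_ord.
  rewrite big1 ?subr0; last first.
    by move=> k _; rewrite ltn_eqF ?mul0r // eN.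
  rewrite !mxE eN eqxx; case: eqP => [<-|_].
    by rewrite ltn_eqF // subr0.
  have jN : (N == j) = false by apply/negbTE; rewrite gtn_eqF.
  by rewrite jN /= eq_sym sub0r; case: (_ == _); rewrite ?oppr0.
rewrite (bigD1 (Ordinal iN)) //= eqxx mul1r big1 ?addr0; last first.
  move=> k; rewrite -val_eqE /= => /negbTE ->; by rewrite mul0r.
rewrite !mxE /= (ltn_eqF iN) -!val_eqE /=.
case: (ltngtP i j) => ij.
- rewrite eqSS (ltn_eqF ij) [j.+1 == i]gtn_eqF ?orbF; last by rewrite ltnS ltnW.
  rewrite (ltn_eqF (_ : i < j.+1)%N) ?subr0 ?sub0r; last by rewrite ltnW.
  by case: eqP; rewrite ?oppr0.
- rewrite eqSS (gtn_eqF ij) [i.+1 == j]gtn_eqF /=; last by rewrite ltnS ltnW.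
  rewrite mulr0n !sub0r oppr0 subr0.
  by rewrite eq_sym; case: eqP => _; rewrite ?mulr0n ?oppr0.
- rewrite ij eqxx (ltn_eqF (ltnSn j)) (gtn_eqF (ltnSn j)).
  by rewrite subr0 sub0r opprK.
Qed.

Lemma Bmx_sym m : (Bmx m)^T = Bmx m.
Proof.
apply/matrixP => i j; rewrite !mxE eq_sym orbC.
by case: eqP => // ->.
Qed.

Lemma fock_a0 (eQ : ('I_N -> R[i]) -> {linear V -> V}) vac lam i v :
  heisenberg -> exponential eQ -> vacuum vac -> fock (eQ lam vac) v ->
  a i 0 v = lam i *: v.
Proof.
move=> H E vacP; elim=> [|j m u m0 _ IH|c u w _ IHu _ IHw].
- have := exp_a E lam i 0 vac.
  rewrite /comm (vac_ann vacP) // raddf0 subr0 => ->.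
  rewrite /lamQ raddf_sum -sumrB.
  have QyE j u : a i 0 (Qy j u) - Qy j (a i 0 u) = (i == j)%:R *: u.
    rewrite /Qy raddf_sum -sumrB.
    rewrite (eq_bigr (fun k => (Bmx 0 i k * (Imx 0)^T k j) *: u)); last first.
      move=> k _; rewrite [X in X - _]linearZ_LR -scalerBr.
      have := heis_a0Q H i k u; rewrite /comm => ->.
      by rewrite scalerA [(Imx 0)^T k j]mxE mulrC.
    rewrite -scaler_suml; congr (_ *: _).
    have -> : \sum_k Bmx 0 i k * (Imx 0)^T k j = (Bmx 0 *m (Imx 0)^T) i j.
      by rewrite mxE.
    by rewrite -{1}Bmx_sym -trmx_mul mulVmx ?Bmx0_unit // !mxE eq_sym.
  rewrite (eq_bigr (fun j => (lam j * (i == j)%:R) *: eQ lam vac)).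
    rewrite -scaler_suml (bigD1 i) //= eqxx mulr1 big1 ?addr0 // => j.
    by rewrite eq_sym => /negbTE ->; rewrite mulr0.
  move=> j _; rewrite -scalerA -QyE scalerBr; congr (_ - _).
  exact: linearZ_LR.
- have /eqP := heis_a0a H i j m u; rewrite /comm subr_eq0 => /eqP ->.
  by rewrite IH linearZ_LR.
- by rewrite linearP IHu IHw scalerDr !scalerA mulrC.
Qed.

End Representation.
End Currents.

(* Main.v *)
Require Import Defs.
From mathcomp Require Import all_boot all_order all_algebra.
From mathcomp Require Import complex.
From mathcomp Require Import all_classical all_reals.
From mathcomp Require Import sequences exp trigo.
From mathcomp Require Import ring lra zify.

Set Implicit Arguments.
Unset Strict Implicit.
Unset Printing Implicit Defensive.

Import Order.TTheory GRing.Theory Num.Theory.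
Local Open Scope ring_scope.
Local Open Scope complex_scope.

(** The identity holds term by term.  Put M = 2N+1 and, for a subset Om of J_N,
let dual Om be the set of those s whose bar is not in Om; this is an involution
exchanging the sizes i and M - i.  The summand of T_(M-i) at dual Om is the
stated multiple of the summand of T_i at Om: the two operators agree up to a
scalar, and the coefficients compensate for that scalar.

Operators.  Fix a mode m <> 0 and write t = x^m, k = j + 1, with positions in
J_N counted from 0.  As s increases, the coordinate of Lambda_s on a_j(m) starts
from the coordinate y of Y_1, drops by t^k when s reaches k and by t^(M-k) when
s reaches M - k.  Inverting B(m) on its first row gives
y (1 + t^M) = t^k + t^(M-k) ([ycoord1]).  As the arguments of the factors of
Lambda_Om run through a geometric progression, the coordinate of Lambda_Om is a
geometric sum which only depends on i and on the numbers of elements of Om below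
k and below M - k ([osc_LOmega_closed]); inserting the value of y makes it
visibly invariant under dual ([dual_closed_form]).  The zero modes are similar,
with t = 1.  Exactly one of Om and dual Om contains the middle index 0, whence
one factor c = [r-1/2]/[1/2] ([scal_LOmega]).

Coefficients.  Read the pairs {k, bar k} from k = N outwards to k = 1, and let
the height go up by one when both members are in Om, down by one when both are
missing, and stay otherwise.  It starts from N, or N + 1 if 0 is in Om, and
ends at i.  A move up from height e contributes Delta(x^(2(e-N))) to d_Om; since
Delta(1/z) = Delta(z), a move down to height e contributes the same factor to
d_(dual Om).  Opposite crossings of a level match, so the two coefficients
differ by the product over the levels between the ends
([prod_crossed_levels], [dOmega_dual]).  These levels give
Delta(x^2) ... Delta(x^(2(N-i))), and one more factor Delta(1) = c^2
([Delta1]) when 0 is in Om: in that case the operator at Om carries the factor c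
that otherwise comes with the operator at dual Om. *)

(** * Counting elements of a subset below a position *)

Section FiniteSets.
Variable n : nat.
Implicit Types (S : {set 'I_n}) (s : 'I_n).

Definition below S (k : nat) : nat := (\sum_(s in S | s < k) 1)%N.

Definition dual S : {set 'I_n} := [set s | rev_ord s \notin S].

Lemma below0 S : below S 0 = 0%N.
Proof. by rewrite /below big1 // => s; rewrite andbF. Qed.

Lemma below_size S : below S n = #|S|.
Proof. by rewrite -sum1_card; apply: eq_bigl => s; rewrite ltn_ord andbT. Qed.

Lemma belowS S s : below S s.+1 = (below S s + (s \in S))%N.
Proof.
rewrite /below (bigID (pred1 s)) /= addnC; congr addn.
  apply: eq_bigl => u; rewrite -val_eqE /= -andbA.
  by case: (u \in S) => //=; lia.
case: (boolP (s \in S)) => sS; last first.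
  by rewrite big1 // => u /andP[/andP[uS _] /eqP us]; rewrite -us uS in sS.
rewrite (big_pred1 s) // => u /=.
by case: eqP => [->|]; rewrite ?andbF ?sS ?ltnSn.
Qed.

Lemma leq_below S j k : (j <= k)%N -> (below S j <= below S k)%N.
Proof.
move=> jk; rewrite /below !big_mkcondr; apply: leq_sum => s _.
by case: ifP => // sj; rewrite (leq_trans sj jk).
Qed.

Lemma below_leq_card S k : (below S k <= #|S|)%N.
Proof.
by rewrite -sum1_card /below big_mkcondr; apply: leq_sum => s _; case: ifP.
Qed.

Lemma below_enum_val S (p : 'I_#|S|) : below S (enum_val p) = p.
Proof.
pose s0 : 'I_n := enum_val p; pose w := map val (enum S).
have p_lt : (p < size (enum S))%N by rewrite -cardE.
have w_sorted : sorted <%O w.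
  have : sorted <%O (map val (Finite.enum 'I_n)).
    by rewrite -enumT val_enum_ord; exact: iota_ltn_sorted.
  rewrite /w !sorted_map => /sorted_filter; apply.
  by move=> b a c; exact: lt_trans.
have := count_lt_nth 0%N w_sorted.
rewrite size_map => /(_ _ p_lt); rewrite (nth_map s0) // -enum_val_nth.
by rewrite count_map => e; rewrite -[RHS]e /below -big_enum_cond sum1_count.
Qed.

(** This turns the sums over ranks that make up Lambda_Om into sums with an
explicit cut, to which the geometric summation applies. *)
Lemma leq_enum_val S (p : 'I_#|S|) k :
  (k <= enum_val p)%N = (below S k <= p)%N.
Proof.
apply/idP/idP => [/(leq_below S)|]; first by rewrite below_enum_val.
apply: contraTT; rewrite -!ltnNge => /(leq_below S).
by rewrite belowS below_enum_val enum_valP addn1.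
Qed.

(** Reversal turns the elements of the dual below k into the non-elements of S
among the last k positions. *)
Lemma below_dual S k :
  (k <= n)%N -> (below (dual S) k + #|S| = k + below S (n - k))%N.
Proof.
elim: k => [|k IH] kn; first by rewrite below0 subn0 below_size.
have := belowS (dual S) (Ordinal kn).
have /= := belowS S (rev_ord (Ordinal kn)).
rewrite inE subnSK // => e -> /=; have := IH (ltnW kn); rewrite e.
by case: (_ \in S) => /=; lia.
Qed.

Lemma dualK : involutive dual.
Proof. by move=> S; apply/setP => s; rewrite !inE rev_ordK negbK. Qed.

Lemma card_dual S : #|dual S| = (n - #|S|)%N.
Proof.
have := below_dual S (leqnn n); rewrite below_size subnn below0; lia.
Qed.

End FiniteSets.

(** * Powers of x *)

Section Powers.
Variables (R : realType) (x lx : R[i]).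
Hypotheses (x_gt0 : 0 < `|x|) (x_lt1 : `|x| < 1) (lxP : cexp lx = x).

Lemma cexpD (y z : R[i]) : cexp (y + z) = cexp y * cexp z.
Proof.
case: y z => [a b] [c d]; rewrite /cexp /= expRD cosD sinD.
by apply/eqP; rewrite eq_complex /=; apply/andP; split; apply/eqP; ring.
Qed.

Lemma norm_cexp (z : R[i]) : `|cexp z| = (expR (complex.Re z))%:C.
Proof.
rewrite /cexp normrM !normc_def /= cos2Dsin2 sqrtr1 mulr1 expr0n /= addr0.
by rewrite sqrtr_sqr ger0_norm ?expR_ge0.
Qed.

Lemma xpowD (c d : R[i]) : xpow lx (c + d) = xpow lx c * xpow lx d.
Proof. by rewrite /xpow mulrDl cexpD. Qed.

Lemma xpow0 : xpow lx 0 = 1.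
Proof. by rewrite /xpow mul0r /cexp /= expR0 cos0 sin0 mul1r. Qed.

Lemma xpowN (c : R[i]) : xpow lx (- c) = (xpow lx c)^-1.
Proof.
have e : xpow lx (- c) * xpow lx c = 1 by rewrite -xpowD addNr xpow0.
have nz : xpow lx c != 0.
  by apply/eqP => z; move/eqP: e; rewrite z mulr0 eq_sym oner_eq0.
by rewrite -[RHS]mul1r -e mulfK.
Qed.

Lemma xpow_double (c : R) : xpow lx (2 * c)%:C = xpow lx c%:C ^+ 2.
Proof. by rewrite mulr_natl mulr2n rmorphD xpowD expr2. Qed.

Lemma xpow_neq0 (c : R[i]) : xpow lx c != 0.
Proof.
apply/eqP => e; have := xpowD (- c) c.
by rewrite addNr xpow0 e mulr0 => /eqP; rewrite oner_eq0.
Qed.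

Lemma xpow1 : xpow lx 1 = x.
Proof. by rewrite /xpow mul1r. Qed.

Lemma x_neq0 : x != 0.
Proof. by rewrite -normr_gt0. Qed.

Lemma xpow_int (m : int) : xpow lx m%:~R = x ^ m.
Proof.
have xpow_nat (k : nat) : xpow lx k%:R = x ^+ k.
  by elim: k => [|k IH]; rewrite ?xpow0 // mulrSr xpowD IH xpow1 exprSr.
case: m => k; first exact: xpow_nat.
by rewrite NegzE mulrNz xpowN -exprnN xpow_nat.
Qed.

Lemma Re_lx_lt0 : complex.Re lx < 0.
Proof. by move: x_lt1; rewrite -lxP norm_cexp -[1]/(1%:C) ltcR expR_lt1. Qed.

Lemma norm_xpow (c : R) : `|xpow lx c%:C| = (expR (c * complex.Re lx))%:C.
Proof. by rewrite norm_cexp; case: lx => a b /=; rewrite mul0r subr0. Qed.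

Lemma xpow_neq1 (c : R) : c != 0 -> xpow lx c%:C != 1.
Proof.
move=> c0; apply/eqP => /(congr1 Num.norm); rewrite norm_xpow normr1.
move=> /(congr1 (@complex.Re R)) /= /eqP; rewrite -expR0 (inj_eq (@expR_inj R)).
by rewrite mulf_eq0 (negbTE c0) lt_eqF ?Re_lx_lt0.
Qed.

(** Keeps the denominator 1 + x^(mM) of the first row of the inverse of B(m)
away from 0, including m = 0. *)
Lemma x_powz_neqN1 (m : int) : x ^ m != -1.
Proof.
apply/eqP => e; have /eqP : x ^ (m * 2) = 1.
  by rewrite -exprz_exp e -exprnP sqrrN expr1n.
rewrite -xpow_int -(rmorph_int (real_complex R)).
have [m0|m0] := eqVneq m 0.
  move: e; rewrite m0 expr0z => /eqP.
  by rewrite -subr_eq0 opprK -mulr2n pnatr_eq0.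
by rewrite (negbTE (xpow_neq1 _)) // intr_eq0 mulf_neq0.
Qed.

Lemma x_powz_neq1 (m : int) : m != 0 -> x ^ m != 1.
Proof.
move=> m0; rewrite -xpow_int -(rmorph_int (real_complex R)).
by rewrite xpow_neq1 ?intr_eq0.
Qed.

Lemma xBinvx_neq0 : x - x^-1 != 0.
Proof.
rewrite subr_eq0; apply: contra (x_powz_neq1 (m := 2) isT) => /eqP e.
by rewrite -exprnP expr2 {2}e mulfV ?x_neq0.
Qed.

Lemma qint_neq0 (c : R) : c != 0 -> qint x lx c != 0.
Proof.
move=> c0; rewrite /qint mulf_neq0 ?invr_eq0 ?xBinvx_neq0 // subr_eq0.
apply: contra (xpow_neq1 (c := 2 * c) _) => [/eqP e|]; last first.
  by rewrite mulf_neq0 ?pnatr_eq0.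
have -> : (2 * c)%:C = c%:C - (- c)%:C.
  by rewrite -rmorphB /=; congr (_%:C); ring.
by rewrite xpowD xpowN e mulfV ?xpow_neq0.
Qed.

End Powers.

(** * The deformed Cartan matrix B(m) *)

Section CartanMatrix.
Variables (R : realType) (N : nat) (x lx : R[i]).
Hypotheses (x_gt0 : 0 < `|x|) (x_lt1 : `|x| < 1) (lxP : cexp lx = x).

Let x0 : x != 0 := x_neq0 x_gt0.

Lemma qint_double (m : int) : m != 0 ->
  qint x lx (2 * m%:~R) / qint x lx m%:~R = x ^ m + x ^ (- m).
Proof.
move=> m0; have xm0 : x ^ m != 0 by rewrite expfz_neq0.
have d0 := xBinvx_neq0 x_gt0 x_lt1 lxP.
have q0 : qint x lx m%:~R != 0 by rewrite qint_neq0 // intr_eq0.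
apply: (mulIf q0); rewrite divfK // /qint !rmorphN /= !xpowN xpow_double.
rewrite rmorph_int (xpow_int lxP) -[x ^ (- m)]invr_expz.
move: (x ^ m) (x - x^-1) xm0 d0 => u d u0 d0.
by field; rewrite u0 d0.
Qed.

(** Both the exceptional last diagonal entry and the case m = 0 fit one formula
in t = x^m, because [2m]/[m] = t + 1/t, and t + 1/t is 2 at m = 0. *)
Lemma BmxE m i j : Bmx N x lx m i j =
  (i == j :> nat)%:R * (x ^ m + x ^ (- m) - (j.+1 == N)%:R)
  - (i.+1 == j)%:R - (j.+1 == i)%:R.
Proof.
rewrite mxE val_eqE; case: eqP => [<-|ij]; last first.
  rewrite mul0r sub0r; case: (i.+1 =P j) => [<-|_] /=.
    by rewrite (@gtn_eqF i i.+2) ?subr0 // ltnW.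
  by case: (_ == _); rewrite oppr0 ?add0r ?oppr0.
rewrite mul1r (gtn_eqF (ltnSn i)) /= !subr0.
have [->|m0] := eqVneq m 0.
  rewrite oppr0 expr0z -[1 + 1]mulr2n.
  by case: eqP; rewrite ?subr0 // mulr2n addrK.
case: eqP => _; last by rewrite subr0 qint_double.
by rewrite mulrBl qint_double // divff // qint_neq0 // intr_eq0.
Qed.

Lemma sum_pick (F : nat -> R[i]) (k : nat) :
  \sum_(i < N) F i * (i == k :> nat)%:R = F k * (k < N)%:R.
Proof.
have [kN|Nk] := ltnP k N; last first.
  by rewrite mulr0 big1 // => i _; rewrite ltn_eqF ?mulr0 // (leq_trans _ Nk).
rewrite (bigD1 (Ordinal kN)) //= eqxx big1 ?addr0 // => i.
by rewrite -val_eqE /= => /negbTE ->; rewrite mulr0.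
Qed.

(** B(m) acts on rows as the second-order difference operator
(t + 1/t) U_k - U_(k-1) - U_(k+1), with a reflecting end, U_(N+1) = U_N, which
accounts for the exceptional entry, and a free end at 0, where the term U_0 that
B(m) lacks is put back. *)
Lemma row_mul_Bmx m (U : nat -> R[i]) (j : 'I_N) : U N.+1 = U N ->
  ((\row_i U i.+1) *m Bmx N x lx m) 0 j =
  (x ^ m + x ^ (- m)) * U j.+1 - U j - U j.+2 + (j == 0 :> nat)%:R * U 0.
Proof.
move=> UN; rewrite mxE.
under eq_bigr => i _ do rewrite mxE BmxE.
have split_term (i : 'I_N) : U i.+1 *
    ((i == j :> nat)%:R * (x ^ m + x ^ (- m) - (j.+1 == N)%:R)
     - (i.+1 == j)%:R - (j.+1 == i)%:R) =
  (x ^ m + x ^ (- m) - (j.+1 == N)%:R) * (U i.+1 * (i == j :> nat)%:R)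
  - (0 < j)%N%:R * (U i.+1 * (i == j.-1 :> nat)%:R)
  - U i.+1 * (i == j.+1 :> nat)%:R.
  rewrite [j.+1 == i]eq_sym.
  have -> : (i.+1 == j) = (0 < j)%N && (i == j.-1 :> nat) by lia.
  by rewrite -mulnb natrM; ring.
under eq_bigr => i _ do rewrite split_term.
rewrite !sumrB -!mulr_sumr !(sum_pick (fun i => U i.+1)).
clear split_term; move: {j}(nat_of_ord j) (ltn_ord j) => j jN.
rewrite jN (leq_ltn_trans (leq_pred j) jN).
have [lt_jN|eq_jN] : (j.+1 < N)%N \/ j.+1 = N by lia.
  by rewrite lt_jN (ltn_eqF lt_jN); case: j {jN lt_jN} => [|k] /=; ring.
have -> : U j.+2 = U j.+1 by rewrite eq_jN.
by rewrite -eq_jN eqxx ltnn; case: j {jN eq_jN} => [|k] /=; ring.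
Qed.

End CartanMatrix.

(** * The first row of the inverse of B(m) *)

Section Fundamental.
Variables (R : realType) (N : nat) (x lx : R[i]).
Hypotheses (N_ge1 : (1 <= N)%N).
Hypotheses (x_gt0 : 0 < `|x|) (x_lt1 : `|x| < 1) (lxP : cexp lx = x).

Let x0 : x != 0 := x_neq0 x_gt0.

(** The solution of the recursion of B(m) that is invariant under k -> M - k,
hence reflected at the end N, as M = 2N+1. *)
Definition folded (m : int) (k : nat) : R[i] :=
  (x ^ m) ^+ k + (x ^ m) ^+ (N.*2.+1 - k).

Lemma folded0_neq0 m : folded m 0 != 0.
Proof.
rewrite /folded subn0 expr0 addrC addr_eq0.
by rewrite exprnP exprz_exp (x_powz_neqN1 x_lt1 lxP).
Qed.

Lemma folded_fold m : folded m N.+1 = folded m N.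
Proof.
rewrite /folded addrC; congr (_ ^+ _ + _ ^+ _); lia.
Qed.

Lemma folded_rec m k : (k.+1 < N.*2.+1)%N ->
  folded m k + folded m k.+2 = (x ^ m + x ^ (- m)) * folded m k.+1.
Proof.
move=> kN; rewrite /folded -invr_expz.
have -> : (N.*2.+1 - k = (N.*2.+1 - k.+2).+2)%N by lia.
have -> : (N.*2.+1 - k.+1 = (N.*2.+1 - k.+2).+1)%N by lia.
have : x ^ m != 0 by rewrite expfz_neq0.
move: (x ^ m) (_ - _)%N => t e t0; rewrite !exprS.
by field.
Qed.

(** A row in the kernel, extended by U_0 = 0, solves the same recursion as
[folded], so their Casoratian is constant.  It vanishes at the reflecting end,
hence at 0, where [folded] is non-zero; so U_1 = 0 as well, and the recursion
propagates the two zeros. *)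
Lemma Bmx_unit m : Bmx N x lx m \in unitmx.
Proof.
rewrite -row_free_unit; apply: inj_row_free => v vB.
(* The clamp repeats the last entry of the row at N + 1. *)
pose U k := if k is k'.+1 then
  (if insub (minn k' N.-1) is Some i then v 0 i else 0) else 0.
have vU : v = \row_i U i.+1.
  apply/rowP => i; rewrite mxE /U (minn_idPl _) ?valK //.
  by have := ltn_ord i; lia.
have UN : U N.+1 = U N.
  have -> : U N = U N.-1.+1 by rewrite prednK.
  by rewrite /U minnn (minn_idPr (leq_pred N)).
have U00 : U 0 = 0 by [].
clearbody U.
have U_rec k : (k < N)%N -> (x ^ m + x ^ (- m)) * U k.+1 - U k = U k.+2.
  move=> kN; have := congr1 (fun w : 'rV_N => w 0 (Ordinal kN)) vB.
  rewrite vU row_mul_Bmx // U00 mulr0 addr0 mxE => /eqP.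
  by rewrite subr_eq0 => /eqP.
have wronskian k : (k <= N)%N ->
    U k * folded m k.+1 - U k.+1 * folded m k = - (U 1 * folded m 0).
  elim: k => [|k IH] kN; first by rewrite U00 mul0r sub0r.
  rewrite -IH 1?ltnW // -U_rec //.
  have -> : folded m k.+2 = (x ^ m + x ^ (- m)) * folded m k.+1 - folded m k.
    by rewrite -folded_rec; [rewrite addrC addKr | lia].
  ring.
have U1 : U 1 = 0.
  have /eqP := wronskian N (leqnn N); rewrite UN folded_fold subrr eq_sym.
  by rewrite oppr_eq0 mulf_eq0 (negbTE (folded0_neq0 m)) orbF => /eqP.
have U0 k : (k <= N)%N -> U k = 0 /\ U k.+1 = 0.
  elim: k => [|k IH] kN //; case: (IH (ltnW kN)) => e e1.
  by rewrite -U_rec // e e1 mulr0 subrr.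
by rewrite vU; apply/rowP => i; rewrite !mxE; case: (U0 i (ltnW (ltn_ord i))).
Qed.

Lemma ycoord1 m (j : 'I_N) :
  ycoord x lx 1 m j = folded m j.+1 / folded m 0.
Proof.
pose v : 'rV_N := \row_i (folded m i.+1 / folded m 0).
have vB : v *m Bmx N x lx m = \row_i (i == 0 :> nat)%:R.
  apply/rowP => k.
  rewrite (row_mul_Bmx x_gt0 x_lt1 lxP m (U := fun k => folded m k / _)).
    rewrite /= divff ?folded0_neq0 // mulr1 mxE mulrA -mulrBl -mulrBl.
    rewrite -folded_rec; last by have := ltn_ord k; lia.
    by rewrite [folded m k + _]addrC addrK subrr mul0r add0r.
  by rewrite folded_fold.
have -> : ycoord x lx 1 m j = (v *m Bmx N x lx m *m Imx N x lx m) 0 j.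
  rewrite vB mxE /ycoord big_mkcond; apply: eq_bigr => i _.
  by rewrite mxE eqSS; case: eqP; rewrite ?mul1r ?mul0r.
by rewrite mulmxK ?Bmx_unit // mxE.
Qed.

End Fundamental.

(** * The operators Lambda_s *)

Section Currents.
Variables (R : realType) (N : nat) (r : R) (x lx : R[i]).
Hypotheses (N_ge1 : (1 <= N)%N).
Hypotheses (x_gt0 : 0 < `|x|) (x_lt1 : `|x| < 1) (lxP : cexp lx = x).

Lemma xpow_mode (k : nat) (m : int) : xpow lx (- k%:R) ^ (- m) = (x ^ m) ^+ k.
Proof.
rewrite -[k%:R]/((k%:Z)%:~R) -rmorphN (xpow_int lxP) exprz_exp mulrNN mulrC.
by rewrite -exprz_exp.
Qed.

(** All Lambda_s arise from Y_1 by scalings and by divisions by some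
A_k(x^(-e) z), where e is always the position of s counted from 0. *)
Definition divA (u : vertex R N) (e k : nat) : vertex R N :=
  vmul u (vinv (vsubst (xpow lx (- e%:R)) (A N r k))).

Lemma osc_divA u e k m j :
  osc (divA u e k) m j = osc u m j - (j.+1 == k)%:R * (x ^ m) ^+ e.
Proof. by rewrite /= xpow_mode mulrC. Qed.

Lemma zero_divA u e k j :
  Defs.zero (divA u e k) j = Defs.zero u j - r%:C * (j.+1 == k)%:R.
Proof. by []. Qed.

Lemma scal_divA u e k : scal (divA u e k) = scal u.
Proof. by rewrite /= invr1 mulr1. Qed.

Lemma LzeroE : Lzero N r x lx =
  vscale (qint x lx (r - 2^-1) / qint x lx 2^-1)
    (divA (Lpos N r x lx N.-1) N N).
Proof. by []. Qed.

Lemma Lbar0 : Lbar N r x lx 0 =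
  vscale (qint x lx 2^-1 / qint x lx (r - 2^-1)) (divA (Lzero N r x lx) N.+1 N).
Proof. by rewrite /divA -[N.+1%:R]natr1 opprD. Qed.

(** The exponent -2N+k-1 at bar k is minus the position M - k of bar k. *)
Lemma LbarS (j : nat) : (j.+1 < N)%N -> Lbar N r x lx j.+1 =
  divA (Lbar N r x lx j) (N + j.+2) (N - j.+1).
Proof.
move=> jN; rewrite /divA.
have -> : (N + j.+2)%:R = 2 * N%:R - (N - j.+1)%:R + 1 :> R[i].
  by rewrite natrB ?(ltnW jN) // natrD -addn2 -[j.+1]addn1 !natrD; ring.
by rewrite !opprD opprK.
Qed.

(** The generator a_j enters Lambda_s exactly when s reaches the positions j + 1
and its mirror image M - (j + 1).  The coordinate phi is arbitrary, to serve
both the oscillators and the zero modes. *)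
Lemma Lambda_coordinate (phi : vertex R N -> R[i]) (j : 'I_N) (g : nat -> R[i])
    (s : J N) :
  (forall c u, phi (vscale c u) = phi u) ->
  (forall u e k, phi (divA u e k) = phi u - (j.+1 == k)%:R * g e) ->
  phi (Lambda r x lx s) = phi (Y N r x lx 1)
    - (j.+1 <= s)%N%:R * g j.+1
    - (N.*2.+1 - j.+1 <= s)%N%:R * g (N.*2.+1 - j.+1)%N.
Proof.
move=> phi_scale phi_divA; set y := phi (Y _ _ _ _ _).
have jN := ltn_ord j; have sM := ltn_ord s.
have phi_Lpos k : phi (Lpos N r x lx k) = y - (j.+1 <= k)%N%:R * g j.+1.
  elim: k => [|k IH]; first by rewrite mul0r subr0.
  rewrite -[Lpos _ _ _ _ _]/(divA (Lpos N r x lx k) k.+1 k.+1) phi_divA IH.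
  rewrite [in RHS]leq_eqVlt ltnS; case: eqP => [->|_] /=.
    by rewrite ltnn !mul0r subr0.
  by rewrite mul0r subr0.
rewrite /Lambda; case: ltnP => [sN|Ns].
  rewrite phi_Lpos [(_ - _ <= s)%N]leqNgt.
  by rewrite (_ : (s < _)%N) ?mul0r ?subr0 //; lia.
have phi_Lzero : phi (Lzero N r x lx) = y - g j.+1.
  rewrite LzeroE phi_scale phi_divA phi_Lpos.
  have [eN|neN] := eqVneq j.+1 N.
    by rewrite eN leqNgt prednK // leqnn mul0r subr0 mul1r.
  by rewrite (_ : (j.+1 <= N.-1)%N) ?mul0r ?mul1r ?subr0 //; lia.
case: eqP => [sN|sN].
  by rewrite phi_Lzero sN jN mul1r [(_ - _ <= N)%N]leqNgt
    (_ : (N < _)%N) ?mul0r ?subr0 //; lia.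
have phi_Lbar k : (k < N)%N -> phi (Lbar N r x lx k) =
    y - g j.+1 - (N.*2.+1 - j.+1 <= N.+1 + k)%N%:R * g (N.*2.+1 - j.+1)%N.
  elim: k => [|k IH] kN.
    rewrite Lbar0 phi_scale phi_divA phi_Lzero.
    have -> : (N.*2.+1 - j.+1 <= N.+1 + 0)%N = (j.+1 == N) by lia.
    case: eqP => [->|_]; rewrite ?mul0r //.
    by have -> : (N.*2.+1 - N = N.+1)%N by lia.
  rewrite LbarS // phi_divA (IH (ltnW kN)) -addrA -opprD.
  congr (_ - _).
  have -> : (N.*2.+1 - j.+1 <= N.+1 + k.+1)%N =
    (N.*2.+1 - j.+1 <= N.+1 + k)%N || (j.+1 == N - k.+1)%N by lia.
  case: eqP => [e|_]; last by rewrite orbF mul0r addr0.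
  rewrite orbT leqNgt (_ : (_ < _)%N) ?mul0r ?add0r ?mul1r; last by lia.
  by congr g; lia.
rewrite phi_Lbar; last by lia.
have -> : (N.+1 + (s - N.+1) = s)%N by lia.
by rewrite (_ : (j < s)%N) ?mul1r //; lia.
Qed.

Lemma osc_Lambda (s : J N) m j : osc (Lambda r x lx s) m j =
  ycoord x lx 1 m j - (j.+1 <= s)%N%:R * (x ^ m) ^+ j.+1
  - (N.*2.+1 - j.+1 <= s)%N%:R * (x ^ m) ^+ (N.*2.+1 - j.+1).
Proof.
pose g e := (x ^ m) ^+ e.
apply: (@Lambda_coordinate (fun u => osc u m j) j g) => //.
by move=> u e k; exact: osc_divA.
Qed.

Lemma zero_Lambda (s : J N) j : Defs.zero (Lambda r x lx s) j =
  r%:C * (1 - (j.+1 <= s)%N%:R - (N.*2.+1 - j.+1 <= s)%N%:R).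
Proof.
pose phi (u : vertex R N) := Defs.zero u j.
rewrite -[LHS]/(phi _) (@Lambda_coordinate phi j (fun=> r%:C)) /phi //;
  last first.
  by move=> u e k; rewrite zero_divA mulrC.
rewrite /= (ycoord1 N_ge1 x_gt0 x_lt1 lxP) /folded expr0z !expr1n -mulr2n.
by rewrite divff ?pnatr_eq0 // mulr1; ring.
Qed.

Lemma qint_half_neq0 : qint x lx 2^-1 != 0.
Proof. by rewrite qint_neq0 // invr_eq0 pnatr_eq0. Qed.

Definition mid_scale : R[i] := qint x lx (r - 2^-1) / qint x lx 2^-1.

Lemma scal_Lambda (s : J N) : 1 < r ->
  scal (Lambda r x lx s) = if s == N :> nat then mid_scale else 1.
Proof.
move=> r1; have scal_Lpos k : scal (Lpos N r x lx k) = 1.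
  by elim: k => [|k IH] //; rewrite -[LHS]/(scal (divA _ _ _)) scal_divA.
have scal_Lzero : scal (Lzero N r x lx) = mid_scale.
  by rewrite LzeroE -[LHS]/(_ * scal (divA _ _ _)) scal_divA scal_Lpos mulr1.
rewrite /Lambda; case: ltngtP => // sN.
have sM := ltn_ord s.
have : (s - N.+1 < N)%N by lia.
elim: (_ - _)%N => [|k IH] kN.
  rewrite Lbar0 -[LHS]/(_ * scal (divA _ _ _)) scal_divA scal_Lzero /mid_scale.
  have : qint x lx (r - 2^-1) != 0 by rewrite qint_neq0 //; lra.
  by have := qint_half_neq0 => h1 h2; field; rewrite h1 h2.
by rewrite LbarS // scal_divA IH // ltnW.
Qed.

End Currents.

(** * Normally ordered products along a subset *)

Section GeometricSums.
Variable F : fieldType.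

Lemma sum_step (n a : nat) : (a <= n)%N ->
  \sum_(p < n) (a <= p)%N%:R = n%:R - a%:R :> F.
Proof.
move=> an; rewrite -(big_mkord xpredT (fun p => (a <= p)%N%:R)).
pose f p : F := (maxn a p)%:R.
rewrite (eq_bigr (fun p => f p.+1 - f p)) => [|p _].
  by rewrite telescope_sumr // /f maxn0 (maxn_idPr an).
rewrite /f; case: (boolP (a <= p)%N) => [ap|]; last rewrite -ltnNge => ap.
  by rewrite (maxn_idPr (leqW ap)) (maxn_idPr ap) -natr1 addrAC subrr add0r.
by rewrite (maxn_idPl ap) (maxn_idPl (ltnW ap)) subrr.
Qed.

(** The summand times t - 1/t is a difference of consecutive values of
t^(n - 2 max(a,p)), which is constant for p <= a. *)
Lemma sum_step_geometric (t : F) (n a : nat) : t != 0 -> (a <= n)%N ->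
  (t - t^-1) * \sum_(p < n) (a <= p)%N%:R * t ^ (n%:Z - 1 - 2 * p%:Z)
  = t ^ (n%:Z - 2 * a%:Z) - t ^ (- n%:Z).
Proof.
move=> t0 an; rewrite mulr_sumr.
rewrite -(big_mkord xpredT
  (fun p : nat => (t - t^-1) * ((a <= p)%N%:R * t ^ (n%:Z - 1 - 2 * p%:Z)))).
pose f (p : nat) : F := - t ^ (n%:Z - 2 * (maxn a p)%:Z).
rewrite (eq_bigr (fun p => f p.+1 - f p)) => [|p _].
  rewrite telescope_sumr // /f maxn0 (maxn_idPr an) opprK addrC.
  by congr (_ - _ ^ _); lia.
rewrite /f; case: (boolP (a <= p)%N) => [ap|]; last first.
  rewrite -ltnNge => ap.
  by rewrite (maxn_idPl ap) (maxn_idPl (ltnW ap)) subrr mul0r mulr0.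
rewrite (maxn_idPr (leqW ap)) (maxn_idPr ap) mul1r.
have -> : n%:Z - 2 * p%:Z = n%:Z - 1 - 2 * p%:Z + 1 by lia.
have -> : n%:Z - 2 * p.+1%:Z = n%:Z - 1 - 2 * p%:Z - 1 by lia.
by rewrite !expfzDr // expr1z exprN1; ring.
Qed.

Lemma sum_three_steps (t y g h : F) (n a b : nat) :
  t != 0 -> (a <= n)%N -> (b <= n)%N ->
  (t - t^-1) * \sum_(p < n) t ^ (n%:Z - 1 - 2 * p%:Z)
    * (y - (a <= p)%N%:R * g - (b <= p)%N%:R * h)
  = y * (t ^ n%:Z - t ^ (- n%:Z))
    - g * (t ^ (n%:Z - 2 * a%:Z) - t ^ (- n%:Z))
    - h * (t ^ (n%:Z - 2 * b%:Z) - t ^ (- n%:Z)).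
Proof.
move=> t0 an bn; pose w (p : nat) := t ^ (n%:Z - 1 - 2 * p%:Z).
have geom := sum_step_geometric t0.
have := geom n 0%N (leq0n n); rewrite mulr0 subr0 => <-; rewrite -!geom //.
rewrite (eq_bigr (fun p : 'I_n => y * ((0 <= p)%N%:R * w p)
  - g * ((a <= p)%N%:R * w p) - h * ((b <= p)%N%:R * w p))) => [|p _].
  by rewrite !sumrB -!mulr_sumr; ring.
by rewrite -/(w p) leq0n mul1r; ring.
Qed.

(** The two sides differ by a multiple of the equation for y.  The exponents are
those of [osc_LOmega_closed], k + l being M, with the counts of the dual set
on the left. *)
Lemma dual_closed_form (t y : F) (n n' k l a b a' b' : nat) :
  t != 0 -> (n' + n = k + l)%N -> (a' + n = k + b)%N -> (b' + n = l + a)%N ->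
  y * (1 + t ^+ k * t ^+ l) = t ^+ k + t ^+ l ->
  y * (t ^ n'%:Z - t ^ (- n'%:Z))
    - t ^+ k * (t ^ (n'%:Z - 2 * a'%:Z) - t ^ (- n'%:Z))
    - t ^+ l * (t ^ (n'%:Z - 2 * b'%:Z) - t ^ (- n'%:Z))
  = y * (t ^ n%:Z - t ^ (- n%:Z))
    - t ^+ k * (t ^ (n%:Z - 2 * a%:Z) - t ^ (- n%:Z))
    - t ^+ l * (t ^ (n%:Z - 2 * b%:Z) - t ^ (- n%:Z)).
Proof.
move=> t0 en ea eb.
have -> : n'%:Z - 2 * a'%:Z = l%:Z + (- k%:Z + (n%:Z - 2 * b%:Z)) by lia.
have -> : n'%:Z - 2 * b'%:Z = k%:Z + (- l%:Z + (n%:Z - 2 * a%:Z)) by lia.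
have -> : n'%:Z = k%:Z + (l%:Z + - n%:Z) by lia.
move: (n%:Z - 2 * b%:Z) (n%:Z - 2 * a%:Z) => B A.
rewrite !opprD !opprK !(expfzDr _ _ t0) -!invr_expz -!exprnP.
have := expf_neq0 k t0; have := expf_neq0 l t0; have := expf_neq0 n t0.
move: (t ^+ k) (t ^+ l) (t ^+ n) (t ^ A) (t ^ B) => p q u tA tB u0 q0 p0 y_eq.
apply/eqP; rewrite -subr_eq0; apply/eqP.
transitivity ((p + q - y * (1 + p * q)) * (u / (p * q) - u^-1)).
  by field; rewrite u0 p0 q0.
by rewrite y_eq subrr mul0r.
Qed.

End GeometricSums.

Section OrderedProducts.
Variables (R : realType) (N : nat) (r : R) (x lx : R[i]).
Hypotheses (N_ge1 : (1 <= N)%N) (r_gt1 : 1 < r).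
Hypotheses (x_gt0 : 0 < `|x|) (x_lt1 : `|x| < 1) (lxP : cexp lx = x).
Implicit Type (Om : {set J N}).

Let x0 : x != 0 := x_neq0 x_gt0.

Lemma osc_LOmega Om m j : osc (LOmega r x lx Om) m j =
  \sum_(p < #|Om|) (x ^ m) ^ (#|Om|%:Z - 1 - 2 * p%:Z)
     * osc (Lambda r x lx (enum_val p)) m j.
Proof.
rewrite /LOmega (@big_morph _ _ (fun u : vertex R N => osc u m j) 0 +%R) //.
apply: eq_bigr => p _ /=; congr (_ * _).
rewrite exprz_exp; have -> : m * (#|Om|%:Z - 1 - 2 * p%:Z) =
  (- #|Om|%:Z + 1 + 2 * p%:Z) * - m by ring.
by rewrite -exprz_exp -(xpow_int lxP) !rmorphD rmorphN rmorphM.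
Qed.

Lemma zero_LOmega Om j : Defs.zero (LOmega r x lx Om) j =
  r%:C * ((below Om j.+1)%:R + (below Om (N.*2.+1 - j.+1))%:R - #|Om|%:R).
Proof.
rewrite /LOmega (@big_morph _ _ (fun u : vertex R N => Defs.zero u j) 0 +%R) //.
under eq_bigr => p _ do rewrite /= zero_Lambda // !leq_enum_val.
rewrite -mulr_sumr !sumrB !sum_step ?below_leq_card // sumr_const card_ord.
by ring.
Qed.

Lemma osc_LOmega_closed Om m (j : 'I_N) (n := #|Om|) (t := x ^ m) (k := j.+1)
    (y := ycoord x lx 1 m j) :
  (t - t^-1) * osc (LOmega r x lx Om) m j =
  y * (t ^ n%:Z - t ^ (- n%:Z))
  - t ^+ k * (t ^ (n%:Z - 2 * (below Om k)%:Z) - t ^ (- n%:Z))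
  - t ^+ (N.*2.+1 - k)
    * (t ^ (n%:Z - 2 * (below Om (N.*2.+1 - k))%:Z) - t ^ (- n%:Z)).
Proof.
have t0 : t != 0 by rewrite expfz_neq0.
rewrite osc_LOmega.
under eq_bigr => p _ do rewrite osc_Lambda // !leq_enum_val.
by rewrite (sum_three_steps y _ _ t0) ?below_leq_card.
Qed.

Lemma zero_LOmega_dual Om j :
  Defs.zero (LOmega r x lx (dual Om)) j = Defs.zero (LOmega r x lx Om) j.
Proof.
rewrite !zero_LOmega; congr (_ * _).
have kM : (j.+1 <= N.*2.+1)%N by have := ltn_ord j; lia.
have /(congr1 (fun e => e%:R : R[i])) := below_dual Om kM.
have /(congr1 (fun e => e%:R : R[i])) := below_dual Om (leq_subr j.+1 N.*2.+1).
rewrite subKn // card_dual !natrD !natrB //; last first.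
  by rewrite -[X in (_ <= X)%N]card_ord max_card.
move=> /(canRL (addrK _)) -> /(canRL (addrK _)) ->; ring.
Qed.

(** For m <> 0, t - 1/t can be cancelled from the closed forms. *)
Lemma osc_LOmega_dual Om m j : m != 0 ->
  osc (LOmega r x lx (dual Om)) m j = osc (LOmega r x lx Om) m j.
Proof.
move=> m0; have t0 : x ^ m != 0 by rewrite expfz_neq0.
have tBtV : x ^ m - (x ^ m)^-1 != 0.
  rewrite subr_eq0; apply: contra (x_powz_neq1 x_lt1 lxP (m := m * 2) _).
    move=> /eqP e; rewrite -exprz_exp -exprnP expr2 {2}e divff //.
  by rewrite mulf_neq0.
apply: (mulfI tBtV); rewrite !osc_LOmega_closed card_dual.
have kM : (j.+1 <= N.*2.+1)%N by have := ltn_ord j; lia.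
have cM : (#|Om| <= N.*2.+1)%N by rewrite -[X in (_ <= X)%N]card_ord max_card.
have := below_dual Om kM.
have := below_dual Om (leq_subr j.+1 N.*2.+1); rewrite subKn //.
move=> below_hi below_lo.
have y_eq : ycoord x lx 1 m j
      * (1 + (x ^ m) ^+ j.+1 * (x ^ m) ^+ (N.*2.+1 - j.+1))
    = (x ^ m) ^+ j.+1 + (x ^ m) ^+ (N.*2.+1 - j.+1).
  rewrite (ycoord1 N_ge1 x_gt0 x_lt1 lxP) -exprD subnKC //.
  have := folded0_neq0 N x_lt1 lxP m; rewrite /folded expr0 subn0.
  by move=> /divfK ->.
by apply: dual_closed_form y_eq => //; rewrite subnK ?subnKC.
Qed.

Definition mid : J N := inord N.

Lemma val_mid (s : J N) : (s == N :> nat) = (s == mid).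
Proof.
rewrite -(inj_eq val_inj) /mid /=; congr (_ == _).
by rewrite inordK // ltnS -addnn leq_addr.
Qed.

(** The scalar picked up at Lambda_0 is removed again at Lambda_(bar N), so only
the middle index contributes. *)
Lemma scal_LOmega Om :
  scal (LOmega r x lx Om) = if mid \in Om then mid_scale r x lx else 1.
Proof.
rewrite /LOmega (@big_morph _ _ (@scal R N) 1 *%R) //.
under eq_bigr => p _ do rewrite /= scal_Lambda // val_mid.
rewrite -(big_enum_val
  (fun s : J N => if s == mid then mid_scale r x lx else 1)).
have [mid_in|mid_out] := boolP (mid \in Om).
  rewrite (bigD1 mid) //= eqxx big1 ?mulr1 // => s /andP[_].
  by move/negbTE => ->.
rewrite big1 // => s sOm; case: eqP => // sN.
by move: mid_out; rewrite -sN sOm.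
Qed.

End OrderedProducts.

(** * The coefficients d_Om *)

Section CancellingMoves.
Variables (F : comNzRingType) (f : nat -> F) (E : nat -> nat).
Variables (up dn : nat -> bool).

(** A path with steps of size at most one crosses each level up as often as
down, except for the levels between its ends, which are crossed once more in one
direction.  The path runs from E n to E 0, and one of the two interval products
is empty.  Products on both sides stand for a quotient because Delta can
vanish. *)
Lemma prod_crossed_levels (n : nat) :
  (forall k, (k < n)%N ->
     ~~ (up k && dn k) /\ (E k + dn k = E k.+1 + up k)%N) ->
  (\prod_(k < n) if dn k then f (E k.+1).-1 else 1)
    * \prod_(E n <= e < E 0) f e
  = (\prod_(k < n) if up k then f (E k.+1) else 1)
    * \prod_(E 0 <= e < E n) f e.
Proof.
elim: n => [|n IH] moves; first by rewrite !big_ord0 !big_geq.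
have := IH (fun k kn => moves k (ltnW kn)).
have [] := moves n (ltnSn n); rewrite !big_ord_recr /=.
move: (\prod_(k < n) _) (\prod_(k < n) _) => D U.
case: (up n) (dn n) => -[] //= _; rewrite ?addn0 ?addn1.
- move=> ->; have [e0|e0] := leqP (E 0) (E n.+1).
    rewrite [in X in X -> _]big_geq; last exact: ltnW.
    rewrite big_nat_recr //= [in X in _ -> X]big_geq // => e.
    by rewrite mulr1 in e *; rewrite e; ring.
  rewrite [\prod_(E 0 <= _ < _) _]big_geq // => e.
  rewrite big_ltn // [\prod_(E 0 <= _ < _) _]big_geq; last exact: ltnW.
  by rewrite !mulr1 in e *; rewrite -e; ring.
- move=> <- /=; have [e0|e0] := leqP (E 0) (E n).
    rewrite [in X in X -> _]big_geq // => e.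
    rewrite [in LHS]big_geq ?big_nat_recr //=; last exact: ltnW.
    by rewrite !mulr1 in e *; rewrite e; ring.
  rewrite [in X in X -> _]big_ltn // [\prod_(E 0 <= _ < _) _]big_geq;
    last exact: ltnW.
  rewrite [\prod_(E 0 <= _ < _) _]big_geq // => e.
  by rewrite !mulr1 in e *; rewrite -e; ring.
- by move=> ->; rewrite !mulr1.
Qed.

End CancellingMoves.

Section Coefficients.
Variables (R : realType) (N : nat) (r : R) (x lx : R[i]).
Hypotheses (x_gt0 : 0 < `|x|) (x_lt1 : `|x| < 1) (lxP : cexp lx = x).

Let x0 : x != 0 := x_neq0 x_gt0.

Lemma neg_exponent : (- (2 * r) + 1)%:C = - (2 * r - 1)%:C.
Proof. by rewrite -rmorphN opprB addrC. Qed.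

(** Numerator and denominator are both palindromic quadratic polynomials. *)
Lemma Delta_inv (z : R[i]) : z != 0 -> Delta r x lx z^-1 = Delta r x lx z.
Proof.
move=> z0.
have palindrome (p : R[i]) : p != 0 ->
    (1 - p * z^-1) * (1 - p^-1 * z^-1)
    = z ^- 2 * ((1 - p * z) * (1 - p^-1 * z)).
  by move=> p0; field; rewrite z0 p0.
rewrite /Delta neg_exponent xpowN !palindrome ?xpow_neq0 //.
by rewrite -mulf_div divff ?mul1r // invr_eq0 expf_neq0.
Qed.

Lemma Delta1 : Delta r x lx 1 = mid_scale r x lx ^+ 2.
Proof.
rewrite /Delta /mid_scale /qint neg_exponent !rmorphN /= !xpowN.
have h2 : xpow lx 2^-1%:C ^+ 2 = x.
  by rewrite -xpow_double divff ?pnatr_eq0 // (xpow1 lxP).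
have -> : (2 * r - 1)%:C = (2 * (r - 2^-1))%:C.
  by rewrite mulrBr divff ?pnatr_eq0.
rewrite xpow_double; move: (x - x^-1) (xBinvx_neq0 x_gt0 x_lt1 lxP) => d d0.
have := xpow_neq0 lx (r - 2^-1)%:C; have := xpow_neq0 lx 2^-1%:C.
have := x_powz_neq1 x_lt1 lxP (m := 1) isT; rewrite expr1z -h2.
move: (xpow lx (r - 2^-1)%:C) (xpow lx 2^-1%:C) => w h h2_neq1 h0 w0.
by field; rewrite h0 w0 d0 -expr2 -opprB oppr_eq0 subr_eq0 eq_sym h2_neq1.
Qed.

(** The factor of d_Om contributed by a pair at height e. *)
Definition pair_factor (e : nat) : R[i] :=
  Delta r x lx (xpow lx (2 * (e%:R - N%:R))).

Lemma pair_factor_mid : pair_factor N = mid_scale r x lx ^+ 2.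
Proof. by rewrite /pair_factor subrr mulr0 xpow0 Delta1. Qed.

Lemma pair_factor_sym e :
  (e <= N.*2)%N -> pair_factor (N.*2 - e) = pair_factor e.
Proof.
move=> eN; rewrite /pair_factor -(Delta_inv (xpow_neq0 _ _)) -xpowN.
congr (Delta _ _ _ (xpow _ _)).
by rewrite natrB // -muln2 natrM; ring.
Qed.

Lemma prod_pair_factor i : (i <= N)%N -> \prod_(i <= e < N) pair_factor e =
  \prod_(1 <= k < (N - i).+1) Delta r x lx (xpow lx (2 * k%:R)).
Proof.
move=> iN; rewrite big_add1 big_nat_rev /= -[X in index_iota X N]add0n big_addn.
rewrite big_nat [RHS]big_nat; apply: eq_bigr => k /andP[_ kN].
rewrite -pair_factor_sym; last by lia.
have -> : (N.*2 - (i + N - (k + i).+1) = N + k.+1)%N by lia.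
by rewrite /pair_factor natrD addrAC subrr add0r.
Qed.

(** The number of elements of Om from position k up to its mirror image 2N - k,
shifted by k so as to change by at most one from each k to the next. *)
Definition height (Om : {set J N}) (k : nat) : nat :=
  (below Om (N.*2.+1 - k) - below Om k + k)%N.

Definition has_pair (Om : {set J N}) (k : nat) : bool :=
  (inord k \in Om) && (rev_ord (inord k : J N) \in Om).

(** For s and bar s in Om, the difference q - p is one more than the number of
elements of Om strictly between them, so that half of the exponent in d_Om is
the height at s + 1 minus N. *)
Lemma dOmega_height (Om : {set J N}) : dOmega r x lx Om =
  \prod_(k < N) if has_pair Om k then pair_factor (height Om k.+1) else 1.
Proof.
pose D (s t : J N) := Delta r x lx (xpow lx (2 * ((below Om t)%:R
  - (below Om s)%:R + s.+1%:R - N%:R - 1))).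
rewrite /dOmega.
have inner (p : 'I_#|Om|) : \prod_(q < #|Om| | (p < q)%N &&
      (enum_val q == rev_ord (enum_val p)))
    Delta r x lx (xpow lx (2 * (q%:R - p%:R + (enum_val p).+1%:R - N%:R - 1)))
  = \prod_(t in Om | (enum_val p < t)%N && (t == rev_ord (enum_val p)))
      D (enum_val p) t.
  rewrite [RHS]big_enum_val_cond /=; apply: eq_big => q.
    by rewrite leq_enum_val belowS below_enum_val enum_valP addn1.
  by rewrite /D !below_enum_val.
rewrite (eq_bigr _ (fun p _ => inner p)) {inner}.
rewrite -(big_enum_val (fun s : J N =>
  \prod_(t in Om | (s < t)%N && (t == rev_ord s)) D s t)).
rewrite (big_ord_widen N.*2.+1
  (fun k => if has_pair Om k then pair_factor (height Om k.+1) else 1));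
  last first.
  by rewrite -addnn ltnW // ltnS leq_addr.
rewrite big_mkcond [RHS]big_mkcond; apply: eq_bigr => s _.
have sM := ltn_ord s.
have [sN|Ns] := ltnP s N; last first.
  case: ifP => // _; rewrite big_pred0 // => t.
  case: eqP => [->|_]; last by rewrite !andbF.
  rewrite andbT /=; apply/negbTE.
  by rewrite negb_and -leqNgt orbC (_ : (_ <= s)%N) //; lia.
rewrite /has_pair inord_val; case: ifP => //= sOm.
case: (boolP (rev_ord s \in Om)) => rOm; last first.
  rewrite big_pred0 // => t; case: eqP => [->|_]; last by rewrite !andbF.
  by rewrite (negbTE rOm).
rewrite (big_pred1 (rev_ord s)) => [|t]; last first.
  rewrite /=; case: eqP => [->|_]; last by rewrite !andbF.
  by rewrite rOm andbT /=; lia.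
rewrite /D /pair_factor /height /=; congr (Delta _ _ _ (xpow _ (_ * _))).
have := belowS Om s; rewrite sOm addn1 => below_s.
rewrite natrD natrB ?leq_below //; last by lia.
by rewrite below_s -[(below Om s).+1]addn1 natrD; ring.
Qed.

(** Missing pairs of Om are exactly the pairs of its dual. *)
Lemma heightS (Om : {set J N}) k : (k < N)%N ->
  (height Om k + has_pair (dual Om) k = height Om k.+1 + has_pair Om k)%N.
Proof.
move=> kN; pose s : J N := inord k.
have s_k : s = k :> nat by rewrite inordK //; lia.
have := belowS Om s; have := belowS Om (rev_ord s).
have : (below Om k.+1 <= below Om (N.*2.+1 - k.+1))%N by apply: leq_below; lia.
rewrite /has_pair /height -/s !inE rev_ordK /= s_k subnSK; last by lia.
move=> le_below -> e; move: le_below; rewrite e.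
case: (s \in Om); case: (rev_ord s \in Om); rewrite /= ?addn0 ?addn1; lia.
Qed.

Lemma height_dual (Om : {set J N}) k : (k <= N)%N ->
  (height (dual Om) k + height Om k = N.*2.+1)%N.
Proof.
move=> kN; have kM : (k <= N.*2.+1)%N by lia.
have := below_dual Om kM; have := below_dual Om (leq_subr k N.*2.+1).
rewrite subKn // /height.
have := @leq_below _ Om k (N.*2.+1 - k).
have := @leq_below _ (dual Om) k (N.*2.+1 - k).
lia.
Qed.

Lemma dOmega_dual (Om : {set J N}) : (#|Om| <= N)%N ->
  dOmega r x lx (dual Om) = dOmega r x lx Om
    * (\prod_(1 <= k < (N - #|Om|).+1) Delta r x lx (xpow lx (2 * k%:R)))
    * (if mid N \in Om then mid_scale r x lx ^+ 2 else 1).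
Proof.
move=> cN.
have height0 : height Om 0 = #|Om|.
  by rewrite /height subn0 below_size below0 subn0 addn0.
have heightN : height Om N = (N + (mid N \in Om))%N.
  have midN : mid N = N :> nat by apply/eqP; rewrite val_mid.
  have := belowS Om (mid N); rewrite midN /height => e.
  have -> : (N.*2.+1 - N = N.+1)%N by lia.
  by rewrite e addKn addnC.
have := @prod_crossed_levels _ pair_factor (height Om)
  (has_pair Om) (has_pair (dual Om)) N.
move=> /(_ _); rewrite -dOmega_height height0 heightN => telescoping.
have -> : dOmega r x lx (dual Om) =
    \prod_(k < N)
      if has_pair (dual Om) k then pair_factor (height Om k.+1).-1 else 1.
  rewrite dOmega_height; apply: eq_bigr => k _; case: ifP => // _.
  have height_pos : (0 < height Om k.+1)%N by rewrite /height addnS.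
  have sum_heights := height_dual Om (ltn_ord k).
  by rewrite -pair_factor_sym; [congr pair_factor; lia | lia].
have := telescoping _; rewrite [\prod_(_ <= _ < #|Om|) _]big_geq; last first.
  by rewrite (leq_trans cN) // leq_addr.
rewrite mulr1 => ->.
  rewrite -mulrA; congr (_ * _); rewrite -prod_pair_factor //.
  case: (mid N \in Om); last by rewrite addn0 mulr1.
  by rewrite addn1 big_nat_recr //= pair_factor_mid.
move=> k kN; split; last exact: heightS.
by rewrite /has_pair !inE rev_ordK; case: (_ \in Om); rewrite ?andbF.
Qed.

End Coefficients.

(** * The duality *)

(** The modes m <> 0 suffice because words have no letter of mode 0. *)
Lemma vcoef_proportional (R : realType) (N : nat) (lx : R[i])
    (V : lmodType R[i])
    (a : 'I_N -> int -> {linear V -> V}) (lam : 'I_N -> R[i])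
    (u u' : vertex R N) (b b' : R[i]) (n : int) (v : V) :
  Defs.zero u' =1 Defs.zero u ->
  (forall (m : int) j, m != 0 -> osc u' m j = osc u m j) ->
  b' * scal u' = b * scal u ->
  b' *: vcoef lx a lam u' n v = b *: vcoef lx a lam u n v.
Proof.
move=> zeroE oscE scalE.
have zeroE_sum : \sum_j Defs.zero u' j * lam j = \sum_j Defs.zero u j * lam j.
  by apply: eq_bigr => j _; rewrite zeroE.
rewrite /vcoef zeroE_sum !scalerA ![_ * (scal _ * _)]mulrA scalE.
congr (_ *: _).
apply: eq_fsbigr => w; rewrite inE => -[/allP nz _]; congr (_ * _ *: _).
by rewrite big_seq [RHS]big_seq; apply: eq_bigr => l /nz /oscE ->.
Qed.

Theorem proposition3p1 (R : realType) (N : nat) (r : R) (x lx : R[i])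
    (V : lmodType R[i])
    (a : 'I_N -> int -> {linear V -> V}) (Q : 'I_N -> {linear V -> V})
    (eQ : ('I_N -> R[i]) -> {linear V -> V}) (vac : V) (lam : 'I_N -> R[i])
    (N_ge1 : (1 <= N)%N) (r_gt1 : 1 < r)
    (x_gt0 : 0 < `|x|) (x_lt1 : `|x| < 1) (lxP : cexp lx = x)
    (heisP : heisenberg r x lx a Q) (eQP : exponential x lx a Q eQ)
    (vacP : vacuum a vac) :
  forall i : nat, (i <= N)%N ->
  forall (n : int) (v : V), fock a (eQ lam vac) v ->
    T r x lx a lam (N.*2.+1 - i)%N n v =
    (qint x lx (r - 2^-1) / qint x lx 2^-1
       * \prod_(1 <= k < (N - i).+1) Delta r x lx (xpow lx (2 * k%:R)))
    *: T r x lx a lam i n v.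
Proof.
move=> i iN n v _; rewrite /T (reindex_inj (inv_inj (@dualK _))) /= scaler_sumr.
have card_le (Om : {set J N}) : (#|Om| <= N.*2.+1)%N.
  by rewrite -[X in (_ <= X)%N]card_ord max_card.
have iM : (i <= N.*2.+1)%N by lia.
apply: eq_big => [Om|Om].
  by rewrite card_dual; move: #|Om| (card_le Om) => c cM; apply/eqP/eqP; lia.
rewrite card_dual => /eqP card_eq.
have {card_eq}cardOm : #|Om| = i.
  by move: #|Om| (card_le Om) card_eq => c cM; lia.
rewrite scalerA; apply: vcoef_proportional => [j|m j m0|].
- by apply: zero_LOmega_dual.
- by apply: osc_LOmega_dual.
rewrite dOmega_dual ?cardOm // !scal_LOmega // inE -/(mid_scale r x lx).
have -> : rev_ord (mid N) = mid N by apply: val_inj; rewrite /= inordK; lia.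
by case: (mid N \in Om) => /=; ring.
Qed.
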